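(* Let $\mathcal S=(s_1,\dots,s_r)$ be a strictly increasing sequence of positive integers, let $\Pi_{\mathcal S}\subset\mathbb R^r$ be the corresponding permutohedron, and let $L\subset\mathbb R^r$ be the hyperplane $\{x_a=x_b\}$ for some $a\ne b$ in $\{1,\dots,r\}$. Put $\Pi_L=\Pi_{\mathcal S}\cap L$. Then there exists a diffeomorphism $\psi$ between $\Pi_L$ and $\Pi_{(s_1,\dots,s_{r-1})}$. Moreover, if $\mathfrak p=(\mathcal P_1,\dots,\mathcal P_{k+1})$ is a partition of $\{1,\dots,r\}$, then: - if $a,b$ do not belong to the same subset of the partition, then $\Pi_{\mathfrak p}\cap L$ is empty; - if $a,b$ belong to the same subset of the partition, then $\Pi_{\mathfrak p}\cap L$ is mapped by $\psi$ diffeomorphically to $\Pi_{\mathfrak p^b}$, the face of $\Pi_{(s_1,\dots,s_{r-1})}$ associated with the reduction $\mathfrak p^b$.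
   Context: For a strictly increasing sequence $\mathcal S=(s_1,\dots,s_r)$ of positive integers, the permutohedron $\Pi_{\mathcal S}\subset\mathbb R^r$ is the convex hull of the points $(s_{\tau(1)},\dots,s_{\tau(r)})$ over all permutations $\tau$ of $\{1,\dots,r\}$. Partitions are ordered partitions into non-empty subsets. The face $\Pi_{\mathfrak p}$ of $\Pi_{\mathcal S}$ associated with $\mathfrak p=(\mathcal P_1,\dots,\mathcal P_{k+1})$ is the codimension-$k$ face cut out by the equations $\sum_{i\in\mathcal P_1\cup\dots\cup\mathcal P_j}x_i=s_1+\dots+s_{|\mathcal P_1|+\dots+|\mathcal P_j|}$ for $j=1,\dots,k$ (for $k=0$ it is $\Pi_{\mathcal S}$ itself). Permutohedra and their intersections with hyperplanes are regarded as manifolds with corners. Reduction: if no $\mathcal P_i$ equals the singleton $\{b\}$, the reduction of $\mathfrak p$ with respect to $b$ is the partition $\mathfrak p^b=(\mathcal P_1^b,\dots,\mathcal P_{k+1}^b)$ of $\{1,\dots,r-1\}$ in which $x\in\mathcal P_i$, $x<b$ contributes $x\in\mathcal P_i^b$, and $x\in\mathcal P_i$, $x>b$ contributes $x-1\in\mathcal P_i^b$. *)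

(* Defs.v *)
From HB Require Import structures.
From mathcomp Require Import all_boot all_order all_algebra perm.
From mathcomp Require Import all_classical all_reals all_analysis.

Set Implicit Arguments.
Unset Strict Implicit.
Unset Printing Implicit Defensive.

Import Order.TTheory GRing.Theory Num.Theory.
Import numFieldNormedType.Exports.

Local Open Scope classical_set_scope.
Local Open Scope ring_scope.

(* Smooth means C^infinity. *)
Definition smooth_open (R : realType) (m n : nat)
    (U : set 'rV[R]_m) (f : 'rV[R]_m -> 'rV[R]_n) : Prop :=
  open U /\
  forall (vs : seq 'rV[R]_m) (x : 'rV[R]_m), U x ->
    differentiable (foldr (fun v g => 'D_v g) f vs) x.

(* Smoothness on an arbitrary subset of Euclidean space: local extendability
   to smooth maps on open sets.  On a simple polytope, whose smooth structure
   (as a manifold with corners) is induced by the ambient affine space, this is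
   smoothness of maps of manifolds with corners; extending to the ambient space
   off the affine span of the polytope imposes no condition. *)
Definition smooth_on (R : realType) (m n : nat)
    (A : set 'rV[R]_m) (f : 'rV[R]_m -> 'rV[R]_n) : Prop :=
  forall x, A x -> exists (U : set 'rV[R]_m) (g : 'rV[R]_m -> 'rV[R]_n),
    [/\ U x, smooth_open U g & forall y, A y -> U y -> f y = g y].

(* Only the values of [f] on [A] and of its inverse on [B] matter. *)
Definition diffeomorphism (R : realType) (m n : nat)
    (A : set 'rV[R]_m) (B : set 'rV[R]_n) (f : 'rV[R]_m -> 'rV[R]_n) : Prop :=
  smooth_on A f /\
  exists g : 'rV[R]_n -> 'rV[R]_m,
    [/\ smooth_on B g,
        forall x, A x -> B (f x), forall y, B y -> A (g y),
        forall x, A x -> g (f x) = x & forall y, B y -> f (g y) = y].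

Definition convex_hull (R : realType) (n : nat) (A : set 'rV[R]_n) :
    set 'rV[R]_n :=
  smallest (@convex_set R 'rV[R]_n) A.

(* Indices are 0-based: [s i] is s_{i+1}. *)
Definition permutohedron (R : realType) (n : nat) (s : 'I_n -> nat) :
    set 'rV[R]_n :=
  convex_hull [set x : 'rV[R]_n | exists tau : 'S_n, x = \row_i (s (tau i))%:R].

Definition ordered_partition (n k : nat) (P : 'I_k.+1 -> {set 'I_n}) : Prop :=
  [/\ forall i, P i != finset.set0,
      forall i j, i != j -> P i :&: P j = finset.set0
    & forall x, exists i, x \in P i].

(* The equation indexed by [j : 'I_k] involves the blocks [0, ..., j], the first
   [j.+1] blocks; the last block never gives an equation. *)
Definition face (R : realType) (n k : nat) (s : 'I_n -> nat)
    (P : 'I_k.+1 -> {set 'I_n}) : set 'rV[R]_n :=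
  [set x : 'rV[R]_n | permutohedron s x /\
    forall j : 'I_k,
      \sum_(i in (\bigcup_(l < k.+1 | (l <= j)%N) P l)%SET) x 0 i =
      \sum_(i < n | (i < \sum_(l < k.+1 | (l <= j)%N) #|P l|)%N) (s i)%:R].

(* [unlift b x] is [Some x] if [x < b], [Some x.-1] if [x > b], and [None] if
   [x = b]. *)
Definition reduction (n k : nat) (b : 'I_n.+1) (P : 'I_k.+1 -> {set 'I_n.+1}) :
    'I_k.+1 -> {set 'I_n} :=
  fun i => finset.finset
    (fun y : 'I_n => [exists x in P i, unlift b x == Some y]).

Lemma in_reduction (n k : nat) (b : 'I_n.+1) (P : 'I_k.+1 -> {set 'I_n.+1}) i y :
  (y \in reduction b P i) = (lift b y \in P i).
Proof.
rewrite inE; apply/existsP/idP => [[x /andP[xP]]|yP].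
  by case: unliftP => [z ->|//] in xP * => /eqP[<-].
by exists (lift b y); rewrite yP liftK eqxx.
Qed.

Lemma reduction_partition (n k : nat) (b : 'I_n.+1)
    (P : 'I_k.+1 -> {set 'I_n.+1}) :
  ordered_partition P -> (forall i, P i != finset.set1 b) ->
  ordered_partition (reduction b P).
Proof.
case=> Pn0 Pd Pc Pb; split => [i|i j ij|x].
- apply/negP => /eqP r0; have /negP := Pb i; apply.
  rewrite finset.eqEsubset; have Psub : P i \subset finset.set1 b.
    apply/fintype.subsetP => x xP; rewrite finset.inE.
    case: (unliftP b x) => [y xE|->//]; have := finset.in_set0 y.
    by rewrite -r0 in_reduction -xE xP.
  rewrite Psub finset.sub1set; have /finset.set0Pn[x xP] := Pn0 i.
  by have := fintype.subsetP Psub x xP; rewrite finset.inE => /eqP <-.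
- apply/finset.setP => y; rewrite finset.in_setI !in_reduction -finset.in_setI.
  by rewrite (Pd _ _ ij) !finset.in_set0.
- by have [i xP] := Pc (lift b x); exists i; rewrite in_reduction.
Qed.

Definition init_seq (n : nat) (s : 'I_n.+1 -> nat) : 'I_n -> nat :=
  fun i => s (widen_ord (leqnSn n) i).

(* Main.v *)
(* The permutohedron is the base polytope {z | z(A) >= g(A), z([n]) = g([n])},
   z(A) the sum of the z_i with i in A, of the strictly supermodular function
   g(A) = s_1 + ... + s_|A| (Rado).  Merging the two equal coordinates into one
   coordinate x_a + x_b turns Pi_L into another base polytope, whose function is
   again strictly supermodular; so it suffices to compare the base polytopes of
   two such functions g and h on the same set, matching the facet of each A.

   For h = g + e d with e small, take z |-> z + e phi(z), where phi is a
   combination, by a smooth partition of unity, of constant vectors w with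
   w(A) = d(A) for all A in a chain.  Strict supermodularity forces the nearly
   tight sets at a point close to the polytope to form a chain, so near the facet
   of A the map shifts z(A) by exactly e d(A).  Being a small Lipschitz
   perturbation of the identity, it is a diffeomorphism of the whole space.  The
   admissible e is bounded below in terms of the supermodularity gap alone, so
   finitely many such steps lead from g to h along the segment joining them. *)
Require Import Defs.
From HB Require Import structures.
From mathcomp Require Import all_boot all_order all_algebra perm.
From mathcomp Require Import all_classical all_reals all_analysis.
From mathcomp Require Import zify ring lra.
Import Order.TTheory GRing.Theory Num.Theory.
Import numFieldNormedType.Exports.
Local Open Scope classical_set_scope.
Local Open Scope ring_scope.
Set Implicit Arguments.
Unset Strict Implicit.
Unset Printing Implicit Defensive.

(** * Smooth functions *)

Section kdiff.
Context {R : realType}.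
Implicit Type V : normedModType R.

(** Smoothness is [kdiff k] for all [k]. Directional derivatives keep every level scalar valued, so
    closure properties follow by induction on [k]; vector-valued maps are treated coordinatewise. *)
Fixpoint kdiff (k : nat) V (f : V -> R) : Prop :=
  if k is k'.+1 then
    (forall x, differentiable f x) /\ forall v, kdiff k' ('D_v f)
  else True.

Lemma kdiffW k V (f : V -> R) : kdiff k.+1 f -> kdiff k f.
Proof.
elim: k f => //= k IH f [df dDf]; split=> // v; apply: IH; exact: dDf.
Qed.

Lemma kdiff_cst k V (c : R) : kdiff k (fun _ : V => c).
Proof.
elim: k c => //= k IH c; split=> [x|v]; first exact: differentiable_cst.
rewrite (_ : 'D_v _ = fun _ => 0); first exact: IH.
by apply/funext => x; rewrite derive_cst.
Qed.

Lemma kdiffD k V (f g : V -> R) :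
  kdiff k f -> kdiff k g -> kdiff k (fun x => f x + g x).
Proof.
elim: k f g => //= k IH f g [df Df] [dg Dg]; split=> [x|v].
  exact: differentiableD.
rewrite (_ : 'D_v _ = fun x => 'D_v f x + 'D_v g x); first exact: IH.
by apply/funext => x; rewrite deriveD//; apply: diff_derivable.
Qed.

Lemma kdiffM k V (f g : V -> R) :
  kdiff k f -> kdiff k g -> kdiff k (fun x => f x * g x).
Proof.
elim: k f g => // k IH f g kf kg.
have [df Df] := kf; have [dg Dg] := kg; split=> [x|v].
  exact: differentiableM.
rewrite (_ : 'D_v _ = fun x => f x * 'D_v g x + g x * 'D_v f x).
  by apply: kdiffD; apply: IH; [exact: kdiffW kf|exact: Dg|exact: kdiffW kg|exact: Df].
by apply/funext => x; rewrite deriveM//; exact: diff_derivable.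
Qed.

Lemma kdiff_sum k V (I : Type) (r : seq I) (P : pred I) (f : I -> V -> R) :
  (forall i, P i -> kdiff k (f i)) -> kdiff k (fun x => \sum_(i <- r | P i) f i x).
Proof.
move=> kf; elim: r => [|i r IH].
  by under eq_fun do rewrite big_nil; exact: kdiff_cst.
under eq_fun do rewrite big_cons; case: (boolP (P i)) => // Pi.
by apply: kdiffD => //; exact: kf.
Qed.

Lemma kdiff_prod k V (I : Type) (r : seq I) (P : pred I) (f : I -> V -> R) :
  (forall i, P i -> kdiff k (f i)) -> kdiff k (fun x => \prod_(i <- r | P i) f i x).
Proof.
move=> kf; elim: r => [|i r IH].
  by under eq_fun do rewrite big_nil; exact: kdiff_cst.
under eq_fun do rewrite big_cons; case: (boolP (P i)) => // Pi.
by apply: kdiffM => //; exact: kf.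
Qed.

Lemma kdiffV k V (f : V -> R) :
  (forall x, f x != 0) -> kdiff k f -> kdiff k (fun x => (f x)^-1).
Proof.
move=> f0; elim: k => // k IH kf; have [df Df] := kf; split=> [x|v].
  exact: differentiableV.
rewrite (_ : 'D_v _ = fun x => -1 * ((f x)^-1 * (f x)^-1) * 'D_v f x).
  apply: kdiffM; last exact: Df.
  apply: kdiffM; first exact: kdiff_cst.
  by apply: kdiffM; apply: IH; exact: kdiffW kf.
apply/funext => x; rewrite deriveV//; last exact: diff_derivable.
by rewrite mulN1r -invfM -expr2.
Qed.

Lemma kdiff_linear k V (f : {linear V -> R}) : continuous f -> kdiff k f.
Proof.
case: k => // k cf; split=> [x|v]; first exact: linear_differentiable.
rewrite (_ : 'D_v _ = fun _ => f v); first exact: kdiff_cst.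
apply/funext => x; rewrite deriveE; first by rewrite diff_lin.
exact: linear_differentiable.
Qed.

Lemma kdiff_coord k n (j : 'I_n) : kdiff k (fun x : 'rV[R]_n => x 0 j).
Proof.
have @f : {linear 'rV[R]_n -> R}.
  by exists (fun N : 'rV[R]_n => N 0 j); do 2![eexists]; do ?[constructor];
     rewrite ?mxE// => ? *; rewrite ?mxE//; move=> ?; rewrite !mxE.
by rewrite (_ : (fun _ => _) = f)//; apply: kdiff_linear; exact: coord_continuous.
Qed.

Lemma differentiable_row V n (f : V -> 'rV[R]_n) x :
  (forall j, differentiable (fun y => f y 0 j) x) -> differentiable f x.
Proof.
move=> df.
rewrite (_ : f = \sum_(j < n) (fun y => f y 0 j *: 'e_j)).
  by apply: differentiable_sum => j; exact: differentiableZl.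
apply/funext => y; rewrite [LHS]row_sum_delta fct_sumE//.
Qed.

Lemma derive_row V n (f : V -> 'rV[R]_n) x v :
  differentiable f x -> 'D_v f x = \row_j 'D_v (fun y => f y 0 j) x.
Proof.
move=> df; rewrite derive_mx; last exact: diff_derivable.
by apply/rowP => j; rewrite !mxE.
Qed.

Lemma derive_comp_row V n (f : 'rV[R]_n -> R) (g : V -> 'rV[R]_n) x v :
  differentiable f (g x) -> differentiable g x ->
  'D_v (f \o g) x = \sum_j 'D_('e_j) f (g x) * 'D_v (fun y => g y 0 j) x.
Proof.
move=> df dg; rewrite deriveE; last exact: differentiable_comp.
rewrite diff_comp//= -[X in 'd f _ X]deriveE// derive_row//.
set w := \row_j _; rewrite [w]row_sum_delta linear_sum/=.
apply: eq_bigr => j _; rewrite linearZ/= mxE -deriveE//.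
exact: mulrC.
Qed.

Lemma kdiff_comp_row k V n (f : 'rV[R]_n -> R) (g : V -> 'rV[R]_n) :
  kdiff k f -> (forall j, kdiff k (fun x => g x 0 j)) ->
  kdiff k (fun x => f (g x)).
Proof.
elim: k f g => // k IH f g kf kg.
have [df Df] := kf.
have dg x : differentiable g x by apply: differentiable_row => j; case: (kg j).
split=> [x|v]; first exact: differentiable_comp.
rewrite (_ : 'D_v _ = fun x =>
    \sum_j 'D_('e_j) f (g x) * 'D_v (fun y => g y 0 j) x).
  apply: kdiff_sum => j _; apply: kdiffM; last by have [_] := kg j; exact.
  by apply: (IH ('D_('e_j) f) g) => [|i]; [exact: Df|apply: kdiffW; exact: kg].
by apply/funext => x; rewrite -derive_comp_row.
Qed.

Lemma kdiff_comp k V (f : R -> R) (g : V -> R) :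
  kdiff k (f : R -> R) -> kdiff k g -> kdiff k (fun x => f (g x)).
Proof.
elim: k f g => // k IH f g kf kg.
have [df Df] := kf; have [dg Dg] := kg.
split=> [x|v]; first exact: differentiable_comp.
rewrite (_ : 'D_v _ = fun x => 'D_1 f (g x) * 'D_v g x).
  by apply: kdiffM; [apply: (IH ('D_1 f) g); [exact: Df|apply: kdiffW; exact: kg]|exact: Dg].
apply/funext => x; rewrite deriveE; last exact: differentiable_comp.
rewrite diff_comp//= -[X in 'd f _ X]deriveE//.
rewrite -[X in 'd f _ X]mulr1 -[X in 'd f _ X]/(_ *: _) linearZ/= -deriveE//.
exact: mulrC.
Qed.

Lemma smooth_openT m n (f : 'rV[R]_m -> 'rV[R]_n) :
  (forall j k, kdiff k (fun x => f x 0 j)) -> smooth_open setT f.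
Proof.
move=> kf; split; first exact: openT.
(* Each derivative in [vs] uses up one order, so the induction on [vs] keeps [k] arbitrary. *)
suff: forall vs j k, kdiff k (fun x => foldr (fun v g => 'D_v g) f vs x 0 j).
  by move=> kfv vs x _; apply: differentiable_row => j; case: (kfv vs j 1%N).
elim=> [|v vs IH]//= j k.
set g := foldr _ _ _ in IH *.
rewrite (_ : (fun x => _) = 'D_v (fun x => g x 0 j)).
  by have [_] := IH j k.+1; exact.
apply/funext => x; rewrite derive_row; first by rewrite mxE.
by apply: differentiable_row => i; case: (IH i 1%N).
Qed.

End kdiff.

(** * A smooth step function *)

Section smoothstep.
Context {R : realType}.
Implicit Types (p : {poly R}) (s t : R).

Lemma near_gt (x a : R) : a < x -> \forall y \near x, a < y.
Proof. by rewrite -ltrN2 => /Nlt_nbhsl; apply: filterS => y; rewrite ltrN2. Qed.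

Lemma horner_expRN_bounded p :
  exists2 C, 0 <= C & forall s, 0 <= s -> `|p.[s]| * expR (- s) <= C.
Proof.
have monom k s : 0 <= s -> s ^+ k * expR (- s) <= k`!%:R.
  move=> s0; rewrite expRN ler_pdivrMr ?expR_gt0//.
  case: k => [|k]; first by rewrite expr0 mul1r -expR0 ler_expR.
  rewrite mulrC -ler_pdivrMr ?ltr0n ?fact_gt0//.
  by apply: le_trans (expR_ge1Dxn k s0); rewrite lerDr.
exists (\sum_(i < size p) `|p`_i| * i`!%:R).
  by apply: sumr_ge0 => i _; rewrite mulr_ge0.
move=> s s0; rewrite horner_coef.
apply: (@le_trans _ _ ((\sum_(i < size p) `|p`_i * s ^+ i|) * expR (- s))).
  by rewrite ler_wpM2r ?expR_ge0//; exact: ler_norm_sum.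
rewrite mulr_suml; apply: ler_sum => i _.
rewrite normrM -mulrA ler_wpM2l// (ger0_norm (exprn_ge0 _ s0)).
exact: monom.
Qed.

(* Functions of this form are closed under differentiation, which makes all
   of them smooth at 0. *)
Definition flat p t := if 0 < t then p.[t^-1] * expR (- t^-1) else 0.

(** With [u = t^-1], the derivative in [t] of [p(u) e^(-u)] is [u^2 (p - p')(u) e^(-u)]. At 0 the
    right-hand difference quotient is [h] times a value of [flat ('X^2 * p)], which is bounded. *)
Lemma is_derive_flat p t :
  is_derive t 1 (flat p) (flat ('X^2 * (p - p^`())) t).
Proof.
have [t0|t0|->] := ltgtP t 0.
- rewrite [X in is_derive _ _ _ X](_ : _ = 0); last first.
    by rewrite /flat ltNge (ltW t0).
  apply: (near_eq_is_derive _ (is_derive_cst (0 : R) t 1)).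
  near=> u; rewrite /flat ltNge ltW//.
  by near: u; exact: lt_nbhsl.
- have dV : is_derive t 1 (fun u : R => u^-1) (- t ^- 2).
    apply: is_derive_eq; first by apply: is_deriveV; rewrite gt_eqF.
    by rewrite scaler1.
  have dVN : is_derive t 1 (fun u : R => - u^-1) (t ^- 2).
    by rewrite -[X in is_derive _ _ _ X]opprK; exact: is_deriveN.
  have d1 := is_derive1_comp (is_derive_poly p t^-1) dV.
  have d2 := @is_derive1_comp _ expR (fun u => - u^-1) _ _ _ (is_derive_expR _) dVN.
  apply: (@near_eq_is_derive _ _ _
    ((horner p \o (fun u => u^-1)) * (expR \o (fun u => - u^-1)))).
    near=> u; rewrite /flat ifT; first by [].
    near: u; exact: near_gt.
  apply: (is_derive_eq (is_deriveM d1 d2)).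
  rewrite /flat t0 /= hornerM hornerXn hornerD hornerN /GRing.scale/= exprVn.
  ring.
- rewrite [X in is_derive _ _ _ X](_ : _ = 0); last by rewrite /flat ltxx.
  have [C C0 HC] := horner_expRN_bounded ('X^2 * p).
  suff cv : h^-1 *: ((flat p \o shift 0) (h *: 1) - flat p 0) @[h --> 0^'] --> (0:R).
    by apply: DeriveDef; [apply/cvg_ex; exists 0|exact: cvg_lim].
  apply/cvgrPdist_le => e e0; near=> h.
  have h0 : h != 0 by near: h; exact: nbhs_dnbhs_neq.
  have he : `|h| <= e / (C + 1).
    by near: h; apply: dnbhs0_le; rewrite divr_gt0// ltr_wpDl.
  rewrite sub0r normrN /= addr0 [h *: 1]mulr1 {2}/flat ltxx subr0 /flat.
  case: ifPn => hp; last by rewrite scaler0 normr0 ltW.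
  rewrite /GRing.scale/=.
  have -> : h^-1 * (p.[h^-1] * expR (- h^-1)) =
      h * (('X^2 * p).[h^-1] * expR (- h^-1)).
    by rewrite hornerM hornerXn; field.
  rewrite normrM normrM (ger0_norm (expR_ge0 _)).
  apply: (@le_trans _ _ (`|h| * C)).
    by rewrite ler_wpM2l//; apply: HC; rewrite invr_ge0 ltW.
  apply: le_trans (ler_wpM2r C0 he) _.
  by rewrite mulrAC ler_pdivrMr ?ltr_wpDl// ler_wpM2l ?(ltW e0)// lerDl.
Unshelve. all: by end_near. Qed.

Lemma kdiff_flat k p : kdiff k (flat p).
Proof.
elim: k p => // k IH p.
have df x : differentiable (flat p) x.
  by apply/derivable1_diffP; case: (is_derive_flat p x).
split=> // v.
rewrite (_ : 'D_v _ = fun x => v * flat ('X^2 * (p - p^`())) x).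
  by apply: kdiffM; [exact: kdiff_cst|exact: IH].
apply/funext => x; rewrite deriveE// -[X in 'd _ _ X]mulr1.
rewrite -[X in 'd _ _ X]/(_ *: _) linearZ/= -deriveE//.
by case: (is_derive_flat p x) => _ ->.
Qed.

(** The continuous derivative is bounded on the compact interval from [a] to [b] and vanishes
    outside it, so the mean value theorem applies. *)
Lemma lipschitz_of_locally_constant (f : R -> R) (a b : R) :
  a <= b -> kdiff 2 f ->
  (forall x, x < a -> 'D_1 f x = 0) -> (forall x, b < x -> 'D_1 f x = 0) ->
  exists2 K, 0 <= K & forall x y, `|f x - f y| <= K * `|x - y|.
Proof.
move=> ab [df /(_ 1)[ddf _]] fa fb.
have cd : continuous (fun x => `|'D_1 f x|).
  move=> x; apply: cvg_norm; exact: (differentiable_continuous (ddf x)).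
have [c cab Hc] := EVT_max ab (continuous_subspaceT cd).
pose K := `|'D_1 f c|.
have HK x : `|'D_1 f x| <= K.
  have [xa|ax] := ltP x a; first by rewrite fa// normr0 normr_ge0.
  have [bx|xb] := ltP b x; first by rewrite fb// normr0 normr_ge0.
  by apply: Hc; rewrite in_itv/= ax.
exists K; [exact: normr_ge0|].
suff H x y : x <= y -> `|f y - f x| <= K * `|y - x|.
  move=> x y; have [/H|/ltW/H//] := leP x y.
  by rewrite distrC [`|x - y|]distrC.
move=> xy; have cf : continuous f by move=> z; exact: (differentiable_continuous (df z)).
have dfz z : z \in `]x, y[ -> is_derive z 1 f ('D_1 f z).
  by move=> _; apply: derivableP; exact: diff_derivable.
have [z _ ->] := MVT_segment xy dfz (continuous_subspaceT cf).
by rewrite normrM ler_wpM2r.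
Qed.

Lemma smoothstep_exists (eta : R) : 0 < eta ->
  exists (beta : R -> R) (K : R),
    [/\ forall k, kdiff k beta, forall t, 0 <= beta t <= 1,
        forall t, t <= eta -> beta t = 0,
        forall t, eta *+ 2 <= t -> beta t = 1 &
        0 <= K /\ forall x y, `|beta x - beta y| <= K * `|x - y|].
Proof.
move=> eta0; pose E : R -> R := flat 1.
have E0 t : t <= 0 -> E t = 0 by move=> t0; rewrite /E /flat ltNge t0.
have Egt t : 0 < t -> 0 < E t.
  by move=> t0; rewrite /E /flat t0 hornerC mul1r expR_gt0.
have Ege t : 0 <= E t.
  by have [/E0->|/Egt/ltW] := leP t 0.
(* This denominator never vanishes: for every [t], at least one of [t - eta] and [eta *+ 2 - t] is
   positive. *)
pose d t := E (t - eta) + E (eta *+ 2 - t).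
have d0 t : 0 < d t.
  have [te|te] := ltP eta t; first by rewrite ltr_pwDl ?Egt ?subr_gt0.
  rewrite ltr_wpDl// Egt// subr_gt0; apply: le_lt_trans te _.
  by rewrite mulr2n ltrDl.
pose beta t := E (t - eta) * (d t)^-1.
have kE k : kdiff k E by exact: kdiff_flat.
have kid k : kdiff k (fun t : R => t).
  by apply: (@kdiff_linear _ _ _ idfun); move=> x; exact: cvg_id.
have kE1 k : kdiff k (fun t => E (t - eta)).
  by apply: kdiff_comp => //; apply: kdiffD => //; exact: kdiff_cst.
have kE2 k : kdiff k (fun t => E (eta *+ 2 - t)).
  apply: kdiff_comp => //.
  rewrite (_ : (fun x => _) = fun t => eta *+ 2 + -1 * t); last first.
    by apply/funext => t; rewrite mulN1r.
  by apply: kdiffD; [|apply: kdiffM => //]; exact: kdiff_cst.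
have kb k : kdiff k beta.
  apply: kdiffM => //; apply: kdiffV; last exact: kdiffD.
  by move=> t; rewrite gt_eqF.
have b0 t : t <= eta -> beta t = 0.
  by move=> te; rewrite /beta E0 ?mul0r// subr_le0.
have b1 t : eta *+ 2 <= t -> beta t = 1.
  move=> te; have dE : d t = E (t - eta) by rewrite /d [X in _ + X]E0 ?addr0// subr_le0.
  by rewrite /beta -dE mulfV// gt_eqF.
have [||x xe|x xe|K K0 HK] := @lipschitz_of_locally_constant beta eta (eta *+ 2).
- by rewrite mulr2n lerDl ltW.
- exact: kb.
- rewrite (@near_eq_derive _ _ _ _ (cst (0 : R))); first exact: derive_cst.
  by near=> u; apply: b0; apply: ltW; near: u; exact: lt_nbhsl.
- rewrite (@near_eq_derive _ _ _ _ (cst (1 : R))); first exact: derive_cst.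
  by near=> u; apply: b1; apply: ltW; near: u; exact: lt_nbhsr.
exists beta, K; split=> // t.
rewrite /beta mulr_ge0 ?invr_ge0 ?(ltW (d0 _))//=.
by rewrite ler_pdivrMr// mul1r lerDl.
Unshelve. all: by end_near. Qed.

End smoothstep.

(** * Lipschitz perturbations of the identity *)

Section lipschitz_perturbation.
Context {R : realType}.

Lemma kdiff_det k (V : normedModType R) n (A : V -> 'M[R]_n) :
  (forall i j, kdiff k (fun x => A x i j)) -> kdiff k (fun x => \det (A x)).
Proof.
move=> kA; rewrite /determinant; apply: kdiff_sum => s _.
by apply: kdiffM; [exact: kdiff_cst|apply: kdiff_prod].
Qed.

Lemma kdiff_invmx k (V : normedModType R) n (A : V -> 'M[R]_n) :
  (forall x, A x \in unitmx) -> (forall i j, kdiff k (fun x => A x i j)) ->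
  forall i j, kdiff k (fun x => invmx (A x) i j).
Proof.
move=> Au kA i j.
rewrite (_ : (fun x => _) = fun x =>
    (\det (A x))^-1 * ((-1) ^+ (j + i) * \det (row' j (col' i (A x))))).
  apply: kdiffM.
    apply: kdiffV; last exact: kdiff_det.
    by move=> x; have := Au x; rewrite unitmxE unitfE.
  apply: kdiffM; first exact: kdiff_cst.
  by apply: kdiff_det => a b; under eq_fun do rewrite !mxE.
by apply/funext => x; rewrite /invmx Au !mxE.
Qed.

Lemma continuous_rV_linear n m (A : 'M[R]_(n, m)) :
  continuous (mulmxr A : 'rV[R]_n -> 'rV[R]_m).
Proof.
move=> x; apply: differentiable_continuous; apply: differentiable_row => j.
suff: kdiff 1 (fun y : 'rV[R]_n => (y *m A) 0 j) by case.
under eq_fun do rewrite mxE; apply: kdiff_sum => i _.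
by apply: kdiffM; [exact: kdiff_coord|exact: kdiff_cst].
Qed.

Lemma differentiable_of_expansion (V W : normedModType R) (f : V -> W)
    (df : {linear V -> W}) x :
  continuous df -> f \o shift x = cst (f x) + df +o_ 0 id ->
  differentiable f x /\ 'd f x = df :> (V -> W).
Proof.
move=> cdf e; have dE := diff_unique cdf e; split=> //.
by apply/diff_locallyP; rewrite dE.
Qed.

Lemma contraction_fixpoint n (f : 'rV[R]_n -> 'rV[R]_n) :
  (forall x y, `|f x - f y| <= 2^-1 * `|x - y|) -> exists p, f p = p.
Proof.
move=> ctr; pose X : completeNormedModType R := HB.pack 'rV[R]_n.
have fT : isFun X X setT setT f by split.
pose F : {fun [set: X] >-> [set: X]} := HB.pack f fT.
have ctrF : is_contraction F.
  exists (2^-1)%:nng; split=> /=; first by rewrite invf_lt1// ltr1n.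
  by move=> [x y] _ /=; exact: ctr.
have [p _ pE] := banach_fixed_point ctrF closedT (ex_intro _ 0 I).
by exists p.
Qed.

Variables (n : nat) (phi : 'rV[R]_n -> 'rV[R]_n).
Hypothesis smooth_phi : forall j k, kdiff k (fun x => phi x 0 j).
Hypothesis lip_phi : forall x y, `|phi x - phi y| <= 2^-1 * `|x - y|.

Let F x := x + phi x.
Let jac x : 'M[R]_n := \matrix_(i, j) 'D_('e_i) (fun y => F y 0 j) x.

Let smooth_F j k : kdiff k (fun x => F x 0 j).
Proof.
rewrite (_ : (fun x => _) = fun x : 'rV[R]_n => x 0 j + phi x 0 j).
  by apply: kdiffD => //; exact: kdiff_coord.
by apply/funext => x; rewrite mxE.
Qed.

Let differentiable_F x : differentiable F x.
Proof. by apply: differentiable_row => j; case: (smooth_F j 1%N). Qed.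

(** [phi] absorbs at most half of a distance; hence [F] is injective with a 2-Lipschitz inverse. *)
Let expanding_F x y : `|x - y| <= 2 * `|F x - F y|.
Proof.
have H : `|x - y| <= `|F x - F y| + `|phi x - phi y|.
  apply: le_trans (ler_normB _ _).
  by rewrite [X in _ <= `|X|](_ : _ = x - y)// /F opprD addrACA addrK.
have := lip_phi x y; lra.
Qed.

Let derive_F x v : 'D_v F x = v *m jac x.
Proof.
rewrite derive_row//; apply/rowP => j; rewrite !mxE.
have dFj : differentiable (fun y => F y 0 j) x by case: (smooth_F j 1%N).
rewrite deriveE// [in LHS](row_sum_delta v) linear_sum/=.
by apply: eq_bigr => i _; rewrite linearZ/= -deriveE// !mxE.
Qed.

(** By [expanding_F], the difference quotients of [F] along [v] have norm at least [|v| / 2], and so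
    does their limit [v *m jac x]; the kernel is therefore trivial. *)
Let unit_jac x : jac x \in unitmx.
Proof.
rewrite -row_free_unit -kermx_eq0; apply/rowV0P => v /sub_kermxP vJ.
have dFv : derivable F x v by exact: diff_derivable.
have := cvg_norm dFv; rewrite -/(derive F x v) => cv.
apply/eqP; rewrite -normr_le0 -(@pmulr_rle0 _ 2^-1)//.
rewrite derive_F vJ normr0 in cv.
apply: (cvgr_to_ge (cv _)); near=> h.
have h0 : h != 0 by near: h; exact: nbhs_dnbhs_neq.
rewrite normrZ normfV ler_pdivlMl ?normr_gt0// mulrC -mulrA ler_pdivrMl//.
rewrite mulrC -normrZ.
by have := expanding_F (h *: v + x) x; rewrite addrK.
Unshelve. all: by end_near. Qed.

(** The preimage of [y] is the fixed point of the contraction [x |-> y - phi x]. The derivative of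
    the inverse [G] is the inverse Jacobian of the map taken at [G y], so each order of smoothness
    of [G] yields the next. *)
Lemma lipschitz_perturbation_smooth_inverse :
  exists G : 'rV[R]_n -> 'rV[R]_n,
    [/\ cancel (fun x => x + phi x) G, cancel G (fun x => x + phi x) &
        forall j k, kdiff k (fun x => G x 0 j)].
Proof.
have [y|G GE] := @choice _ _ (fun y x => F x = y).
  have [|x xE] := @contraction_fixpoint n (fun x => y - phi x).
    by move=> x x'; rewrite opprB addrC subrKA distrC.
  by exists x; rewrite /F -[in X in X + _]xE subrK.
have FK : cancel F G.
  move=> x; apply/eqP; rewrite -subr_eq0 -normr_le0.
  by have := expanding_F (G (F x)) x; rewrite GE subrr normr0 mulr0.
have lipG y z : `|G y - G z| <= 2 * `|y - z|.
  by have := expanding_F (G y) (G z); rewrite !GE.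
have dG y : differentiable G y /\ 'd G y = mulmxr (invmx (jac (G y))) :> (_ -> _).
  apply: differentiable_of_expansion; first exact: continuous_rV_linear.
  set A := invmx _.
  have [C C0 HC] := linear_lipschitz (@continuous_rV_linear _ _ A).
  apply/eqaddoP => e e0.
  (* The remainder of [F] at [G y] gets multiplied by the inverse Jacobian, bounded by [C], and the
     increment [k] of [G] is at most twice [h]; this fixes the tolerance. *)
  have /eqaddoP/(_ (e / (2 * C))) := diff_locally (differentiable_F (G y)).
  rewrite divr_gt0 ?mulr_gt0// => /(_ isT) /nbhs_ballP[d /= d0 Hd].
  apply/nbhs_ballP; exists (d / 2) => /=; first by rewrite divr_gt0.
  move=> h; rewrite -ball_normE /= sub0r normrN => hd; pose k := G (h + y) - G y.
  have kh : `|k| <= 2 * `|h| by have := lipG (h + y) y; rewrite addrK.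
  have /Hd : ball 0 d k by rewrite -ball_normE /= sub0r normrN; lra.
  rewrite /= !fctE /= /k subrK !GE -deriveE// derive_F -/k => H.
  have -> : G (h + y) - (G y + mulmxr A h) = - mulmxr A (h + y - (y + k *m jac (G y))).
    rewrite [X in - mulmxr A X](_ : _ = h - k *m jac (G y)); last first.
      by rewrite opprD addrA addrK.
    rewrite linearB/= -mulmxA mulmxV ?unit_jac// mulmx1 opprB /k opprD addrA.
    by [].
  rewrite normrN; apply: le_trans (HC _) _.
  rewrite mulrC -ler_pdivlMr//; apply: le_trans H _.
  apply: le_trans (ler_wpM2l _ kh) _; first by rewrite divr_ge0 ?mulr_ge0 ?ltW.
  rewrite le_eqVlt; apply/orP; left; apply/eqP.
  by field; rewrite gt_eqF.
exists G; split=> // j k; elim: k j => // k IH j.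
have dGj y : differentiable (fun x => G x 0 j) y.
  apply: (@differentiable_comp _ _ _ _ G (fun M : 'rV[R]_n => M 0 j)).
    by case: (dG y).
  exact: differentiable_coord.
split=> // v.
rewrite (_ : 'D_v _ = fun y => \sum_i v 0 i * invmx (jac (G y)) i j).
  apply: kdiff_sum => i _; apply: kdiffM; first exact: kdiff_cst.
  apply: kdiff_invmx => [x|a b]; first exact: unit_jac.
  under eq_fun do rewrite mxE.
  apply: (@kdiff_comp_row _ _ _ _ ('D_('e_a) (fun y => F y 0 b)) G) => //.
  by have [_] := smooth_F b k.+1; exact.
apply/funext => y; have [dGy dE] := dG y.
have := derive_row v dGy => /rowP/(_ j); rewrite mxE => <-.
by rewrite deriveE// dE /= mxE.
Qed.

End lipschitz_perturbation.

(** * Deformation of base polytopes *)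

Section base_polytopes.
Context {R : realType} {n : nat}.
Implicit Types (z w : 'rV[R]_n) (A B : {set 'I_n}) (g h d : {set 'I_n} -> R).

Definition ssum z A : R := \sum_(i in A) z 0 i.

Lemma ssum_modular z A B : ssum z (A :|: B) + ssum z (A :&: B) = ssum z A + ssum z B.
Proof.
rewrite /ssum ![\sum_(i in _) _]big_mkcond -!big_split/=.
apply: eq_bigr => i _; rewrite !inE.
by case: (i \in A); case: (i \in B); rewrite /= ?addr0 ?add0r.
Qed.

Lemma ssum_set0 z : ssum z finset.set0 = 0.
Proof. by rewrite /ssum big_set0. Qed.

Lemma ssumD z w A : ssum (z + w) A = ssum z A + ssum w A.
Proof. by rewrite /ssum -big_split; apply: eq_bigr => i _; rewrite mxE. Qed.

Lemma ssumZ a z A : ssum (a *: z) A = a * ssum z A.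
Proof. by rewrite /ssum mulr_sumr; apply: eq_bigr => i _; rewrite mxE. Qed.

Lemma ssum_sum (I : finType) (f : I -> 'rV[R]_n) A :
  ssum (\sum_i f i) A = \sum_i ssum (f i) A.
Proof.
rewrite /ssum exchange_big; apply: eq_bigr => i _.
by rewrite summxE.
Qed.

Lemma ssum_lipschitz z w A : `|ssum z A - ssum w A| <= n%:R * `|z - w|.
Proof.
rewrite /ssum -sumrB; apply: le_trans (ler_norm_sum _ _ _) _.
rewrite big_mkcond -[n in n%:R]card_ord mulr_natl -sumr_const.
apply: ler_sum => i _; case: ifP => _ //.
rewrite [leRHS]/Num.Def.normr/= mx_normrE.
by apply: le_trans (le_bigmax _ _ (0, i)); rewrite !mxE.
Qed.

Lemma kdiff_ssum k A : kdiff k (ssum^~ A).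
Proof. by apply: kdiff_sum => i _; exact: kdiff_coord. Qed.

Definition base_polytope g : set 'rV[R]_n :=
  [set z | (forall A, g A <= ssum z A) /\ ssum z finset.setT = g finset.setT].

(** Comparable pairs are left out because they always give equality; on all others the excess is
    uniformly at least [c]. *)
Definition supermodular_gap (c : R) g := forall A B,
  ~~ (A \subset B) -> ~~ (B \subset A) ->
  g A + g B + c <= g (A :|: B) + g (A :&: B).

(** Interpolate on the chain without its largest member [A], then correct the value at [A] along a
    coordinate that lies in [A] and in no smaller member. *)
Lemma chain_interpolation d (C : {set {set 'I_n}}) : d finset.set0 = 0 ->
  (forall A B, A \in C -> B \in C -> (A \subset B) || (B \subset A)) ->
  exists w, forall A, A \in C -> ssum w A = d A.
Proof.
move=> d0; move: {2}#|C| (leqnn #|C|) => N.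
elim: N C => [|N IH] C.
  by rewrite leqn0 cards_eq0 => /eqP -> _; exists 0 => A; rewrite inE.
move=> cC chainC.
pose P := [pred A : {set 'I_n} | A \in finset.set0 |: C].
have P0 : P finset.set0 by rewrite /P /= !inE eqxx.
case: (@arg_maxnP _ finset.set0 P (fun A => #|A|) P0) => A /= AC Amax.
have [A0|A0] := eqVneq A finset.set0.
  exists 0 => B BC; have : B == finset.set0.
    by rewrite -cards_eq0 -leqn0 -(cards0 'I_n) -A0 Amax//= !inE BC orbT.
  by move=> /eqP ->; rewrite ssum_set0 d0.
have {}AC : A \in C by move: AC; rewrite !inE (negbTE A0).
have [||w wE] := IH (C :\ A).
- by rewrite (cardsD1 A) AC in cC.
- by move=> B B'; rewrite !inE => /andP[_ BC] /andP[_ B'C]; exact: chainC.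
(* The empty set is adjoined so that a next largest member [B] always exists. All remaining members
   lie in [B], so a coordinate of [A] outside [B] is free. *)
pose Q := [pred B : {set 'I_n} | B \in finset.set0 |: (C :\ A)].
have Q0 : Q finset.set0 by rewrite /Q /= !inE eqxx.
case: (@arg_maxnP _ finset.set0 Q (fun B => #|B|) Q0) => B /= BC Bmax.
have sub X Y : X \in C -> Y \in finset.set0 |: C -> (#|X| <= #|Y|)%N -> X \subset Y.
  move=> XC; rewrite !inE => /predU1P[->|YC] cXY.
    by rewrite cards0 leqn0 cards_eq0 in cXY; rewrite (eqP cXY).
  have /orP[//|YX] := chainC _ _ XC YC.
  by have /eqP -> : Y == X by rewrite eqEcard YX.
have [i iA iB] : exists2 i, i \in A & i \notin B.
  have : B \proper A.
    rewrite finset.properEneq; move: BC; rewrite !inE => /predU1P[->|/andP[BA BC]].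
      by rewrite eq_sym A0 finset.sub0set.
    by rewrite BA sub// ?inE ?AC ?orbT// Amax//= !inE BC orbT.
  by move=> /properP[_].
exists (w + (d A - ssum w A) *: 'e_i) => X XC; rewrite ssumD ssumZ.
have [->|XA] := eqVneq X A.
  have -> : ssum 'e_i A = 1.
    rewrite /ssum (bigD1 i)//= mxE !eqxx big1 ?addr0// => j /andP[_ ji].
    by rewrite mxE eqxx (negbTE ji).
  by rewrite mulr1 addrC subrK.
have -> : ssum 'e_i X = 0.
  rewrite /ssum big1// => j jX; rewrite mxE eqxx /=; case: eqP => // ji.
  case/negP: iB; rewrite -ji; apply: (fintype.subsetP (sub _ _ XC _ _)) jX.
    by move: BC; rewrite !inE => /orP[->|/andP[_ ->]]//; rewrite orbT.
  by apply: Bmax; rewrite /= !inE XA XC orbT.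
by rewrite wE ?inE ?XA// mulr0 addr0.
Qed.

End base_polytopes.

Section deformation.
Context {R : realType} {n : nat}.
Implicit Types (z w : 'rV[R]_n) (A B : {set 'I_n}) (g h d : {set 'I_n} -> R).

(** Diffeomorphisms of the whole space compose without domain conditions. The last clause matches
    the facets set by set, and with them all their intersections. *)
Definition base_equiv g h := exists F G : 'rV[R]_n -> 'rV[R]_n,
  [/\ forall j k, kdiff k (fun x => F x 0 j), forall j k, kdiff k (fun x => G x 0 j),
      cancel F G, cancel G F & forall z, base_polytope g z <-> base_polytope h (F z)] /\
  forall z A, base_polytope g z -> (ssum z A = g A <-> ssum (F z) A = h A).

Lemma base_equiv_refl g : base_equiv g g.
Proof. by exists id, id; split=> //; split=> // j k; exact: kdiff_coord. Qed.

Lemma base_equiv_trans g h d : base_equiv g h -> base_equiv h d -> base_equiv g d.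
Proof.
move=> [F [G [[kF kG FK GK bF] tF]]] [F' [G' [[kF' kG' FK' GK' bF'] tF']]].
exists (F' \o F), (G \o G'); split; last first.
  by move=> z A bz; rewrite tF// tF'//; exact/bF.
split.
- by move=> j k; apply: (@kdiff_comp_row _ _ _ _ (fun y => F' y 0 j)).
- by move=> j k; apply: (@kdiff_comp_row _ _ _ _ (fun y => G y 0 j)).
- exact: can_comp.
- exact: can_comp.
- by move=> z; rewrite bF bF'.
Qed.

Lemma prodr_lipschitz (I : Type) (r : seq I) (a b : I -> R) :
  (forall i, 0 <= a i <= 1) -> (forall i, 0 <= b i <= 1) ->
  `|\prod_(i <- r) a i - \prod_(i <- r) b i| <= \sum_(i <- r) `|a i - b i|.
Proof.
move=> a01 b01; elim: r => [|i r IH]; first by rewrite !big_nil subrr normr0.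
rewrite !big_cons; set p := \prod_(j <- r) a j; set q := \prod_(j <- r) b j.
have -> : a i * p - b i * q = (a i - b i) * p + b i * (p - q) by ring.
have /andP[bi0 bi1] := b01 i.
have p0 : 0 <= p by apply: prodr_ge0 => j _; case/andP: (a01 j).
have p1 : p <= 1 by apply: prodr_ile1.
apply: le_trans (ler_normD _ _) _; rewrite !normrM; apply: lerD.
  by rewrite ler_piMr// ger0_norm.
by apply: le_trans IH; rewrite ler_piMl// ger0_norm.
Qed.

(* The functions attached to the families [C] form a partition of unity on the
   whole space; [C] plays the role of the set of facets close to [z]. *)
Definition near_weight (beta : R -> R) g (C : {set {set 'I_n}}) z : R :=
  \prod_A (if A \in C then 1 - beta (ssum z A - g A) else beta (ssum z A - g A)).

Lemma sum_near_weight beta g z : \sum_C near_weight beta g C z = 1.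
Proof.
transitivity (\prod_(A : {set 'I_n})
    (1 - beta (ssum z A - g A) + beta (ssum z A - g A))).
  by rewrite bigA_distr; apply: eq_bigl => C; rewrite inE.
by apply: big1 => A _; rewrite subrK.
Qed.

Lemma near_weight_bounds beta g C z : (forall t, 0 <= beta t <= 1) ->
  0 <= near_weight beta g C z <= 1.
Proof.
move=> b01; have H A : 0 <= (if A \in C then 1 - beta (ssum z A - g A)
    else beta (ssum z A - g A)) <= 1.
  by have := b01 (ssum z A - g A); case: ifP => _; lra.
rewrite prodr_ge0/=; first by apply: prodr_ile1 => A _; exact: H.
by move=> A _; case/andP: (H A).
Qed.

Lemma near_weight_lipschitz beta K g C z w :
  (forall t, 0 <= beta t <= 1) ->
  (forall s t, `|beta s - beta t| <= K * `|s - t|) -> 0 <= K ->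
  `|near_weight beta g C z - near_weight beta g C w| <=
    #|{set 'I_n}|%:R * (K * n%:R) * `|z - w|.
Proof.
move=> b01 lb K0; rewrite /near_weight.
have H x A : 0 <= (if A \in C then 1 - beta (ssum x A - g A)
    else beta (ssum x A - g A)) <= 1.
  by have := b01 (ssum x A - g A); case: ifP => _; lra.
apply: le_trans (prodr_lipschitz _ (H z) (H w)) _.
rewrite -mulrA mulr_natl -sumr_const big_mkcond [leRHS]big_mkcond/=.
apply: ler_sum => A _.
have hb : `|beta (ssum z A - g A) - beta (ssum w A - g A)| <= K * n%:R * `|z - w|.
  apply: le_trans (lb _ _) _; rewrite -mulrA ler_wpM2l//.
  by rewrite opprB addrA subrK; exact: ssum_lipschitz.
case: ifP => _ //.
by rewrite opprD opprK addrACA subrr add0r addrC distrC.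
Qed.

(** [r] is chosen before [g], so that one step length serves along a whole path of functions. *)
Lemma base_equiv_step (c : R) d : 0 < c -> d finset.set0 = 0 ->
  exists2 r, 0 < r & forall g e, supermodular_gap c g -> `|e| <= r ->
    base_equiv g (fun A => g A + e * d A).
Proof.
(* Call [ssum z A - g A] the slack of [A]. Two incomparable sets of slack below [2 eta], with no
   slack anywhere below [- eta], would force [c < 6 eta]. *)
move=> c0 d0; pose eta := c / 8.
have eta0 : 0 < eta by rewrite divr_gt0.
have [beta [K [kb b01 b0 b1 [K0 lb]]]] := smoothstep_exists eta0.
pose chain (C : {set {set 'I_n}}) :=
  forall A B, A \in C -> B \in C -> (A \subset B) || (B \subset A).
have [C|W WE] := @choice _ _ (fun (C : {set {set 'I_n}}) (w : 'rV[R]_n) =>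
    chain C -> forall A, A \in C -> ssum w A = d A).
  have [cC|] := pselect (chain C); last by exists 0.
  by have [w wE] := chain_interpolation d0 cC; exists w.
(* [r * K1] will bound the error in the shift of any [ssum z A], and [r * K2] the Lipschitz constant
   of [phi]; [r] makes them at most [eta / 4] and [1 / 4]. *)
pose K1 := \sum_(C : {set {set 'I_n}}) \sum_(A : {set 'I_n}) `|ssum (W C) A|
  + \sum_(A : {set 'I_n}) `|d A|.
pose K2 := #|{set 'I_n}|%:R * (K * n%:R) * \sum_(C : {set {set 'I_n}}) `|W C|.
have K10 : 0 <= K1.
  by rewrite addr_ge0// ?sumr_ge0// => C _; exact: sumr_ge0.
have K20 : 0 <= K2 by rewrite !mulr_ge0// sumr_ge0.
pose r := Num.min eta 1 / (4 * (K1 + K2 + 1)).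
have K3 : 0 < K1 + K2 + 1 by rewrite ltr_wpDl// addr_ge0.
have r0 : 0 < r by rewrite divr_gt0 ?mulr_gt0// lt_min eta0 ltr01.
have rK : r * (K1 + K2 + 1) <= eta / 4 /\ r * (K1 + K2 + 1) <= 1 / 4.
  have -> : r * (K1 + K2 + 1) = Num.min eta 1 / 4 by rewrite /r; field; rewrite gt_eqF.
  by rewrite !ler_pM2r ?invr_gt0// !ge_min !lexx orbT.
have rK1 : r * K1 <= eta / 4.
  by apply: le_trans rK.1; rewrite ler_wpM2l ?(ltW r0)//; lra.
have rK2 : r * K2 <= 1 / 4.
  by apply: le_trans rK.2; rewrite ler_wpM2l ?(ltW r0)//; lra.
exists r => // g e gapg er.
pose chi C z := near_weight beta g C z.
pose phi z : 'rV[R]_n := \sum_(C : {set {set 'I_n}}) (e * chi C z) *: W C.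
have kphi j k : kdiff k (fun x => phi x 0 j).
  rewrite (_ : (fun x => _) = fun x => \sum_(C : {set {set 'I_n}}) (e * chi C x) * W C 0 j).
    apply: kdiff_sum => C _; apply: kdiffM; last exact: kdiff_cst.
    apply: kdiffM; first exact: kdiff_cst.
    have kl A : kdiff k (fun z => beta (ssum z A - g A)).
      apply: kdiff_comp => //; apply: kdiffD; first exact: kdiff_ssum.
      exact: kdiff_cst.
    apply: kdiff_prod => A _; case: (A \in C) => //.
    rewrite (_ : (fun z => _) = fun z => 1 + -1 * beta (ssum z A - g A)).
      by apply: kdiffD; [|apply: kdiffM => //]; exact: kdiff_cst.
    by apply/funext => z; rewrite mulN1r.
  by apply/funext => x; rewrite /phi summxE; apply: eq_bigr => C _; rewrite mxE.
have lphi x y : `|phi x - phi y| <= 2^-1 * `|x - y|.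
  apply: (@le_trans _ _ (r * K2 * `|x - y|)); last by rewrite ler_wpM2r//; lra.
  have -> : r * K2 * `|x - y| = \sum_(C : {set {set 'I_n}})
      r * (#|{set 'I_n}|%:R * (K * n%:R) * `|x - y|) * `|W C|.
    by rewrite -mulr_sumr /K2; ring.
  rewrite /phi -sumrB; apply: le_trans (ler_norm_sum _ _ _) _.
  apply: ler_sum => C _; rewrite -scalerBl normrZ ler_wpM2r// -mulrBr normrM.
  by apply: ler_pM => //; exact: near_weight_lipschitz.
have [G [FK GK kG]] := lipschitz_perturbation_smooth_inverse kphi lphi.
(* [dev z A] is the error in the intended shift [e * d A], that is, the slack of [F z] for the new
   function minus the slack of [z] for [g]. *)
pose F z := z + phi z; pose dev z A := ssum (phi z) A - e * d A.
have ssumF z A : ssum (F z) A - (g A + e * d A) = ssum z A - g A + dev z A.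
  by rewrite /F ssumD /dev; ring.
have dev_small z A : `|dev z A| <= eta / 4.
  apply: le_trans rK1; rewrite /dev /phi ssum_sum.
  rewrite /K1 mulrDr; apply: le_trans (ler_normB _ _) _; apply: lerD; last first.
    rewrite normrM; apply: ler_pM => //.
    by rewrite (bigD1 A)//= lerDl; apply: sumr_ge0.
  apply: le_trans (ler_norm_sum _ _ _) _; rewrite mulr_sumr; apply: ler_sum => C _ /=.
  rewrite ssumZ !normrM -mulrA; apply: ler_pM => //.
  have /andP[chi0 chi1] := near_weight_bounds g C z b01.
  rewrite ger0_norm//; apply: (@le_trans _ _ `|ssum (W C) A|).
    by rewrite ler_piMl.
  by rewrite (bigD1 A)//= lerDl; apply: sumr_ge0.
(* Close to the polytope, two facets can be nearly tight simultaneously only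
   if they are comparable, so [phi] shifts each nearby facet by a constant. *)
have dev0 z A : (forall X, - eta <= ssum z X - g X) -> ssum z A - g A <= eta ->
    dev z A = 0.
  move=> lz lA; apply/eqP; rewrite subr_eq0 /phi ssum_sum; apply/eqP.
  rewrite -[e * d A]mul1r -(sum_near_weight beta g z) mulr_suml.
  apply: eq_bigr => C _; rewrite ssumZ -/(chi C z).
  have [-> |chi0] := eqVneq (chi C z) 0; first by rewrite mulr0 !mul0r.
  (* A nonzero weight has no vanishing factor: [C] contains every set of slack at most [eta], where
     [beta] is 0, and none of slack at least [2 eta], where [beta] is 1. *)
  have factor0 B : (if B \in C then 1 - beta (ssum z B - g B)
      else beta (ssum z B - g B)) != 0.
    apply: contraNneq chi0 => B0; rewrite /chi /near_weight (bigD1 B)//=.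
    by rewrite B0 mul0r.
  have AC : A \in C.
    by have := factor0 A; case: ifP => // _; rewrite b0// eqxx.
  suff cC : chain C by rewrite (WE C cC A AC); ring.
  move=> X Y XC YC; apply/negPn/negP; rewrite negb_or => /andP[XY YX].
  have near B : B \in C -> ssum z B - g B < eta *+ 2.
    move=> BC; rewrite ltNge; apply/negP => /b1 Bb.
    by have := factor0 B; rewrite BC Bb subrr eqxx.
  have := gapg _ _ XY YX; have := ssum_modular z X Y.
  have := near _ XC; have := near _ YC.
  have := lz (X :|: Y); have := lz (X :&: Y).
  have : c = 8 * eta by rewrite /eta; field.
  by rewrite mulr2n; lra.
exists F, G; split; last first.
  move=> z A [bz _]; split=> [zA|FA].
    have := ssumF z A; rewrite dev0 ?zA; first by lra.
    - by move=> X; have := bz X; lra.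
    - by lra.
  have := ssumF z A; have := dev_small z A; rewrite FA subrr ler_norml => dz e0.
  have := e0; rewrite dev0; first by lra.
  - by move=> X; have := bz X; lra.
  - by lra.
split=> //.
- move=> j k; rewrite (_ : (fun x => _) = fun x : 'rV[R]_n => x 0 j + phi x 0 j).
    by apply: kdiffD => //; exact: kdiff_coord.
  by apply/funext => x; rewrite mxE.
(* A slack above [eta] stays positive under a change of at most [eta / 4], and a smaller one does
   not change, by [dev0]. Conversely, the slacks of a preimage are at least [- eta / 4], so [dev0]
   applies there too. *)
- move=> z; split=> [[bz zT]|[bF FT]].
    have lz X : - eta <= ssum z X - g X by have := bz X; lra.
    split=> [A|].
      have := ssumF z A; have [lA|lA] := leP (ssum z A - g A) eta.
        by rewrite dev0//; have := bz A; lra.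
      by have := dev_small z A; rewrite ler_norml; lra.
    by have := ssumF z finset.setT; rewrite dev0//; lra.
  have lz X : - eta <= ssum z X - g X.
    by have := ssumF z X; have := dev_small z X; have := bF X; rewrite ler_norml; lra.
  split=> [A|].
    have := ssumF z A; have [lA|lA] := leP (ssum z A - g A) eta; last lra.
    by rewrite dev0//; have := bF A; lra.
  have := ssumF z finset.setT; rewrite dev0//; first by lra.
  by have := ssumF z finset.setT; have := dev_small z finset.setT; rewrite ler_norml; lra.
Qed.

(** The gap inequality is affine in the function, so every point of the segment from [g] to [h] has
    gap [c]. One [r] then serves for all [N] steps, each of length [1 / N <= r]. *)
Lemma base_equiv_supermodular (c : R) g h : 0 < c ->
  g finset.set0 = h finset.set0 ->
  supermodular_gap c g -> supermodular_gap c h -> base_equiv g h.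
Proof.
move=> c0 gh0 gapg gaph; pose d A := h A - g A.
have d0 : d finset.set0 = 0 by rewrite /d gh0 subrr.
have [r r0 step] := base_equiv_step c0 d0.
pose N := (Num.trunc r^-1).+1.
have N0 : 0 < N%:R :> R by rewrite ltr0n.
have Nr : N%:R^-1 <= r.
  by rewrite -[r]invrK lef_pV2 ?posrE ?invr_gt0// ltW// truncnS_gt.
pose gk (k : nat) A := g A + k%:R / N%:R * d A.
have H k : (k <= N)%N -> base_equiv g (gk k).
  elim: k => [|k IH] kN.
    rewrite (_ : gk 0%N = g); first exact: base_equiv_refl.
    by apply/funext => A; rewrite /gk !mul0r addr0.
  apply: base_equiv_trans (IH (ltnW kN)) _.
  rewrite (_ : gk k.+1 = fun A => gk k A + N%:R^-1 * d A); last first.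
    by apply/funext => A; rewrite /gk -addn1 natrD; ring.
  apply: step; last by rewrite ger0_norm// invr_ge0 ltW.
  move=> A B AB BA; have := gapg _ _ AB BA; have := gaph _ _ AB BA.
  rewrite /gk /d; set t := k%:R / N%:R.
  have t0 : 0 <= t by rewrite divr_ge0.
  have t1 : t <= 1 by rewrite ler_pdivrMr// mul1r ler_nat ltnW.
  move=> hAB gAB.
  have t1' : 0 <= 1 - t by lra.
  have := ler_wpM2l t0 hAB; have := ler_wpM2l t1' gAB.
  rewrite !mulrBl !mul1r; lra.
rewrite (_ : h = gk N); first exact: H.
by apply/funext => A; rewrite /gk /d divff ?gt_eqF// mul1r addrC subrK.
Qed.

End deformation.

(** * The permutohedron as a base polytope *)

Section partial_sums.
Context {R : realType} {n : nat} {s : 'I_n -> nat}.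
Hypothesis s_incr : forall i j : 'I_n, (i < j)%N -> (s i < s j)%N.

Definition psum (m : nat) : R := \sum_(i < n | (i < m)%N) (s i)%:R.

Lemma psum0 : psum 0 = 0.
Proof. by rewrite /psum big1. Qed.

Lemma psumS m (mn : (m < n)%N) : psum m.+1 = psum m + (s (Ordinal mn))%:R.
Proof.
rewrite /psum (bigD1 (Ordinal mn))//= addrC; congr (_ + _).
apply: eq_bigl => i; rewrite ltnS [RHS]ltn_neqAle andbC; congr (_ && _).
Qed.

(** Strictly increasing integers: shifting a block of [j] indices by [d > 0] raises each entry by at
    least 1. *)
Lemma psum_shift m j d : (0 < d)%N -> (m + j + d <= n)%N ->
  psum (m + j) - psum m + j%:R <= psum (m + j + d) - psum (m + d).
Proof.
move=> d0; elim: j => [|j IH] jn; first by rewrite !addn0 !subrr addr0.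
have mjn : (m + j < n)%N by lia.
have mjdn : (m + j + d < n)%N by lia.
have e : (m + j.+1 + d = (m + j + d).+1)%N by lia.
have := IH (ltnW mjdn).
rewrite e (psumS mjdn) addnS (psumS mjn) -[j.+1]addn1 natrD.
have : (s (Ordinal mjn))%:R + 1 <= (s (Ordinal mjdn))%:R :> R.
  rewrite natr1 ler_nat.
  by apply: s_incr => /=; lia.
by lra.
Qed.

(** The [b - m] entries from position [m] on are compared with their shift by [a - m], a block that
    ends at [u]. *)
Lemma psum_convex m a b u : (m < a)%N -> (m < b)%N -> (u + m = a + b)%N ->
  (u <= n)%N -> psum a + psum b + 1 <= psum u + psum m.
Proof.
move=> ma mb uab un.
have := @psum_shift m (b - m) (a - m); rewrite subn_gt0 => /(_ ma).
have -> : (m + (b - m) = b)%N by lia.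
have -> : (b + (a - m) = u)%N by lia.
have -> : (m + (a - m) = a)%N by lia.
move=> /(_ un); have : 1 <= (b - m)%:R :> R by rewrite ler1n subn_gt0.
by lra.
Qed.

Lemma psum_le_sum (T : {set 'I_n}) : psum #|T| <= \sum_(i in T) (s i)%:R.
Proof.
have [Tn|nT] := ltnP #|T| n; last first.
  have -> : T = finset.setT.
    by apply/eqP; rewrite eqEcard finset.subsetT cardsT card_ord.
  rewrite /psum cardsT card_ord; rewrite le_eqVlt; apply/orP; left; apply/eqP.
  by apply: eq_big => i; rewrite ?inE ?ltn_ord.
(* [c] is the entry right after the first [#|T|] ones. Once [c] is subtracted from every entry,
   those first ones are nonpositive and all others nonnegative, so no [T] of this size has a smaller
   sum. *)
pose c : R := (s (Ordinal Tn))%:R.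
have widen_inj : injective (widen_ord (ltnW Tn)).
  by move=> i j /(congr1 val) /= ij; exact: val_inj.
have cardI : \sum_(i < n | (i < #|T|)%N) c = \sum_(i in T) c.
  rewrite !sumr_const; congr (_ *+ _).
  rewrite -[RHS](card_ord #|T|) -[RHS](card_imset _ widen_inj).
  apply: eq_card => i; apply/idP/imsetP => [iT|[j _ ->]]; last exact: (ltn_ord j).
  by exists (Ordinal (iT : (i < #|T|)%N)) => //; exact: val_inj.
rewrite -(lerD2r (- \sum_(i in T) c)) -{1}cardI /psum -!sumrB.
rewrite [leLHS]big_mkcond [leRHS]big_mkcond/=; apply: ler_sum => i _.
have le_c : (i < #|T|)%N -> (s i)%:R <= c by move=> iT; rewrite ler_nat ltnW// s_incr.
have c_le : ~~ (i < #|T|)%N -> c <= (s i)%:R.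
  rewrite -leqNgt leq_eqVlt => /predU1P[Ti|Ti]; last by rewrite ler_nat ltnW// s_incr.
  by rewrite /c ler_nat (_ : Ordinal Tn = i)//; exact: val_inj.
case: ifPn => [/le_c|/c_le]; case: ifP => _; lra.
Qed.

(* Weighted cardinalities enter through the coordinate that stands for both
   [x_a] and [x_b] on the hyperplane. *)
Lemma supermodular_psum k (mu : {set 'I_k} -> nat) :
  (forall A B, mu (A :|: B) + mu (A :&: B) = mu A + mu B)%N ->
  (forall A B : {set 'I_k}, A \proper B -> (mu A < mu B)%N) -> (mu finset.setT <= n)%N ->
  supermodular_gap 1 (fun A => psum (mu A)).
Proof.
move=> muM mu_lt muT A B AB BA; apply: psum_convex.
- by apply: mu_lt; rewrite properE finset.subsetIl finset.subsetI subxx AB.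
- by apply: mu_lt; rewrite properE finset.subsetIr finset.subsetI subxx andbT BA.
- exact: muM.
- apply: leq_trans muT; have := finset.subsetT (A :|: B).
  rewrite finset.subEproper => /predU1P[->//|/mu_lt/ltnW//].
Qed.

Lemma supermodular_psum_card : supermodular_gap 1 (fun A : {set 'I_n} => psum #|A|).
Proof.
apply: supermodular_psum => [A B|A B|]; [|exact: proper_card|].
  by rewrite cardsUI.
by rewrite cardsT card_ord.
Qed.

End partial_sums.
Arguments psum {R n} s m.

(** * Tight sets of a strictly supermodular function *)

Section tight_sets.
Context {R : realType} {n : nat} (g : {set 'I_n} -> R) (z : 'rV[R]_n) (c : R).
Hypotheses (c0 : 0 < c) (gap : supermodular_gap c g) (bz : base_polytope g z).

Let tight A := ssum z A == g A.

(** By modularity, two incomparable tight sets would push [ssum z] below [g] on their union or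
    intersection. *)
Lemma tight_comparable A B : tight A -> tight B -> (A \subset B) || (B \subset A).
Proof.
move=> /eqP tA /eqP tB; apply/negPn/negP; rewrite negb_or => /andP[AB BA].
have := gap AB BA; have := ssum_modular z A B.
have [gz _] := bz; have := gz (A :|: B); have := gz (A :&: B).
by have := c0; lra.
Qed.

Lemma tightU A B : tight A -> tight B -> tight (A :|: B).
Proof.
move=> tA tB; have /orP[AB|BA] := tight_comparable tA tB.
  by rewrite (finset.setUidPr AB).
by rewrite (finset.setUidPl BA).
Qed.

Lemma tightI A B : tight A -> tight B -> tight (A :&: B).
Proof.
move=> tA tB; have /orP[AB|BA] := tight_comparable tA tB.
  by rewrite (finset.setIidPl AB).
by rewrite (finset.setIidPr BA).
Qed.

End tight_sets.

Section permutohedron_base.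
Context {R : realType} {n : nat} {s : 'I_n -> nat}.
Hypothesis s_incr : forall i j : 'I_n, (i < j)%N -> (s i < s j)%N.
Implicit Types (z : 'rV[R]_n).

Let g (A : {set 'I_n}) : R := psum s #|A|.

Let gap : supermodular_gap 1 g.
Proof. exact: supermodular_psum_card. Qed.

Lemma convex_base h : convex_set (base_polytope h : set (convex_lmodType 'rV[R]_n)).
Proof.
move=> x y l; rewrite !inE => -[xh xT] [yh yT].
have E A : ssum (l%:num *: x + (1 - l%:num) *: y) A =
    l%:num * ssum x A + (1 - l%:num) * ssum y A by rewrite ssumD !ssumZ.
have l0 : 0 <= l%:num by [].
have l1 : 0 <= 1 - l%:num by rewrite subr_ge0.
split=> [A|]; rewrite E.
  by have := ler_wpM2l l0 (xh A); have := ler_wpM2l l1 (yh A); lra.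
by rewrite xT yT; ring.
Qed.

Lemma permutohedron_sub_base z : permutohedron s z -> base_polytope g z.
Proof.
apply: smallest_sub; first exact: convex_base.
move=> _ [tau ->].
have E A : ssum (\row_i (s (tau i))%:R) A = \sum_(j in tau @: A) (s j)%:R :> R.
  rewrite big_imset/=; last by move=> i j _ _; exact: perm_inj.
  by apply: eq_bigr => i _; rewrite mxE.
have cE (A : {set 'I_n}) : #|tau @: A| = #|A| by rewrite card_imset //; exact: perm_inj.
split=> [A|]; rewrite E /g; first by rewrite -cE; exact: psum_le_sum.
rewrite cardsT card_ord /psum; apply: eq_bigl => i; rewrite ltn_ord.
by apply/imsetP; exists ((tau^-1)%g i); rewrite ?inE ?permKV.
Qed.

Lemma permutohedron_segment x y z (t u : R) : 0 < t -> 0 < u ->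
  (t + u) *: z = u *: x + t *: y -> permutohedron s x -> permutohedron s y ->
  permutohedron s z.
Proof.
move=> t0 u0 zE px py X [cX GX].
have tu : 0 < t + u by exact: addr_gt0.
have l0 : 0 <= u / (t + u) by rewrite divr_ge0 ?ltW.
have l1 : u / (t + u) <= 1 by rewrite ler_pdivrMr// mul1r lerDr ltW.
have := cX x y (Itv01 l0 l1); rewrite !inE => /(_ (px X (conj cX GX)) (py X (conj cX GX))).
congr (X _); rewrite /conv/= /unstable.onem.
have -> : 1 - u / (t + u) = (t + u)^-1 * t by field; rewrite gt_eqF.
rewrite mulrC -!scalerA -scalerDr -zE scalerA mulVf ?scale1r// gt_eqF//.
Qed.

(** Tight sets contain both or neither of [i], [j] and stay tight. Only sets with [j] and without
    [i] lose slack; [t] is the least slack among these, so one of them becomes tight. *)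
Lemma base_slide z (i j : 'I_n) : base_polytope g z -> i != j ->
  (forall A, ssum z A = g A -> (i \in A) = (j \in A)) ->
  exists2 t, 0 < t & base_polytope g (z + t *: ('e_i - 'e_j)) /\
    (#|[set A | ssum (z + t *: ('e_i - 'e_j)) A != g A]%SET| <
     #|[set A | ssum z A != g A]%SET|)%N.
Proof.
move=> [bz zT] ij unsep.
have ssum_e k A : ssum ('e_k : 'rV[R]_n) A = (k \in A)%:R.
  rewrite /ssum; have [kA|kA] := boolP (k \in A).
    rewrite (bigD1 k)//= mxE !eqxx big1 ?addr0// => l /andP[_ lk].
    by rewrite mxE eqxx (negbTE lk).
  by rewrite big1// => l lA; rewrite mxE eqxx/=; case: eqP => // lk; rewrite -lk lA in kA.
have E t A : ssum (z + t *: ('e_i - 'e_j)) A =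
    ssum z A + t * ((i \in A)%:R - (j \in A)%:R).
  by rewrite ssumD ssumZ ssumD -scaleN1r ssumZ !ssum_e mulN1r.
pose P := [pred A : {set 'I_n} | (j \in A) && (i \notin A)].
have P0 : P (finset.set1 j) by rewrite /P /= !inE eqxx ij.
case: (arg_minP (fun A => ssum z A - g A) P0) => A /= /andP[jA iA] Amin.
pose t := ssum z A - g A.
have t0 : 0 < t.
  rewrite lt_neqAle subr_ge0 bz andbT eq_sym subr_eq0; apply/eqP => /unsep.
  by rewrite jA (negbTE iA).
exists t => //; split.
  split=> [B|]; rewrite E; last by rewrite !inE subrr mulr0 addr0.
  have := bz B => Bz; have := Amin B; rewrite -/t.
  case: (i \in B); case: (j \in B); rewrite /= ?mulr1n ?mulr0n => At;
    by [lra | have := At isT; lra].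
apply: proper_card; apply/properP; split.
  apply/fintype.subsetP => B; rewrite !inE; apply: contraNN => /eqP zB.
  by rewrite E zB unsep// subrr mulr0 addr0.
exists A; rewrite !inE; first by rewrite -subr_eq0 gt_eqF.
by rewrite E jA (negbTE iA) /t /= mulr1n mulr0n sub0r mulrN1 opprB addrC subrK eqxx.
Qed.

(** [T i] is the smallest tight set containing [i], and [U i] the largest tight subset of it
    avoiding [i]. Separation makes them differ by [i] alone, so [z 0 i] is a difference of
    consecutive partial sums; comparability of tight sets makes the positions [#|U i|] distinct. *)
Lemma base_vertex z : base_polytope g z ->
  (forall i j, i != j -> exists2 A, ssum z A = g A & (i \in A) != (j \in A)) ->
  exists tau : 'S_n, z = \row_i (s (tau i))%:R.
Proof.
move=> bz sep; pose tight A := ssum z A == g A.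
have tI A B : tight A -> tight B -> tight (A :&: B) := tightI ltr01 gap bz (A := A) (B := B).
have tU A B : tight A -> tight B -> tight (A :|: B) := tightU ltr01 gap bz (A := A) (B := B).
have t0 : tight finset.set0 by rewrite /tight ssum_set0 /g cards0 psum0.
have tT : tight finset.setT by apply/eqP; case: bz.
pose T i := (\bigcap_(A : {set 'I_n} | tight A && (i \in A)) A)%SET.
have tightT i : tight (T i).
  by rewrite /T; elim/big_ind: _ => // A /andP[].
have iT i : i \in T i by apply/bigcapP => A /andP[].
have Tsub i A : tight A -> i \in A -> T i \subset A.
  by move=> tA iA; apply: finset.bigcap_inf; rewrite tA.
pose U i := (\bigcup_(A : {set 'I_n} | tight A && (i \notin A) && (A \subset T i)) A)%SET.
have tightU i : tight (U i).
  by rewrite /U; elim/big_ind: _ => // A /andP[/andP[]].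
have iU i : i \notin U i.
  by apply/bigcupP => -[A /andP[/andP[_ /negP]]].
have TE i : T i = i |: U i.
  apply/finset.setP => j; rewrite in_setU1; have [->|ji] := eqVneq j i; first by rewrite iT.
  apply/idP/bigcupP => [jT|[A /andP[_ /fintype.subsetP AT] /AT//]].
  have [A /eqP tA] := sep j i ji; have [iA|iA] := boolP (i \in A).
    by rewrite (fintype.subsetP (Tsub i A tA iA) j jT).
  rewrite eqbF_neg negbK => jA; exists (A :&: T i); last by rewrite inE jA.
  by rewrite tI// finset.in_setI (negbTE iA) finset.subsetIr.
have cardT i : #|T i| = #|U i|.+1 by rewrite TE cardsU1 iU.
have Un i : (#|U i| < n)%N by rewrite -cardT -[n in (_ <= n)%N]card_ord max_card.
have zE i : z 0 i = (s (Ordinal (Un i)))%:R.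
  have : ssum z (T i) = z 0 i + ssum z (U i).
    by rewrite TE /ssum big_setU1.
  rewrite (eqP (tightT i)) (eqP (tightU i)) /g cardT (psumS (Un i)).
  by move=> e; apply: (@addIr _ (psum s #|U i|)); rewrite -e addrC.
have tau_inj : injective (fun i => Ordinal (Un i)).
  move=> i j /(congr1 val) /= cU; apply/eqP/negPn/negP => ij.
  have TT : T i = T j.
    apply/eqP; have /orP[ij'|ji] := tight_comparable ltr01 gap bz (tightT i) (tightT j).
      by rewrite eqEcard ij' !cardT cU leqnn.
    by rewrite eq_sym eqEcard ji !cardT cU leqnn.
  have [A /eqP tA] := sep i j ij.
  have [iA|iA] := boolP (i \in A).
    by rewrite (fintype.subsetP (Tsub i A tA iA)) ?TT.
  by rewrite eq_sym eqbF_neg negbK => /(Tsub j A tA)/fintype.subsetP/(_ i); rewrite -TT iT (negbTE iA) => /(_ isT).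
by exists (perm tau_inj); apply/rowP => i; rewrite !mxE permE zE.
Qed.

(** Induction on the number of non-tight sets: if some pair of coordinates is not separated by a
    tight set, sliding both ways puts [z] between two points with fewer non-tight sets. *)
Lemma base_sub_permutohedron z : base_polytope g z -> permutohedron s z.
Proof.
move: {2}#|_| (leqnn #|[set A | ssum z A != g A]%SET|) => N.
elim: N z => [|N IH] z cN bz.
  apply: sub_gen_smallest; apply: (base_vertex bz) => i j ij; exists (finset.set1 i).
    apply/eqP/negPn/negP => zi; move: cN; rewrite leqn0 cards_eq0 => /eqP/finset.setP/(_ (finset.set1 i)).
    by rewrite !inE zi.
  by rewrite !inE eqxx [j == i]eq_sym (negbTE ij).
have [sep|] := pselect (forall i j, i != j ->
    exists2 A, ssum z A = g A & (i \in A) != (j \in A)).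
  by apply: sub_gen_smallest; exact: base_vertex.
move=> /existsNP[i] /existsNP[j] /not_implyP[ij nosep].
have unsep A : ssum z A = g A -> (i \in A) = (j \in A).
  by move=> zA; apply/eqP/negPn/negP => ijA; apply: nosep; exists A.
have [t t0 [bt ct]] := base_slide bz ij unsep.
have [|u u0 [bu cu]] := @base_slide z j i bz _ (fun A zA => esym (unsep A zA)).
  by rewrite eq_sym.
apply: (permutohedron_segment t0 u0 _ (IH _ _ bt) (IH _ _ bu)).
- by apply/rowP => l; rewrite !mxE; ring.
- by rewrite -ltnS (leq_trans ct).
- by rewrite -ltnS (leq_trans cu).
Qed.

Lemma permutohedronE : permutohedron s = base_polytope g.
Proof.
apply/seteqP; split=> z; first exact: permutohedron_sub_base.
exact: base_sub_permutohedron.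
Qed.

End permutohedron_base.

(** * Faces and the hyperplane section *)

Section faces.
Context {R : realType}.

Lemma smooth_on_kdiff m n (A : set 'rV[R]_m) (f : 'rV[R]_m -> 'rV[R]_n) :
  (forall j k, kdiff k (fun x => f x 0 j)) -> smooth_on A f.
Proof. by move=> kf x _; exists setT, f; split=> //; exact: smooth_openT. Qed.

Definition blocks n k (P : 'I_k.+1 -> {set 'I_n}) (j : nat) : {set 'I_n} :=
  (\bigcup_(l < k.+1 | (l <= j)%N) P l)%SET.

Lemma card_blocks n k (P : 'I_k.+1 -> {set 'I_n}) j :
  (forall i l, i != l -> P i :&: P l = finset.set0) ->
  #|blocks P j| = (\sum_(l < k.+1 | (l <= j)%N) #|P l|)%N.
Proof.
move=> dP; rewrite /blocks big_mkcond -sum1_card /=.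
pose Q (l : 'I_k.+1) := if (l <= j)%N then P l else finset.set0.
rewrite (@partition_disjoint_bigcup _ _ _ _ _ Q).
  rewrite [RHS]big_mkcond; apply: eq_bigr => l _.
  by rewrite sum1_card /Q; case: ifP; rewrite ?cards0.
move=> i l il; rewrite -setI_eq0 /Q.
by case: ifP; case: ifP; rewrite ?finset.setI0 ?finset.set0I// dP.
Qed.

Lemma faceE n k (s : 'I_n -> nat) (P : 'I_k.+1 -> {set 'I_n}) (x : 'rV[R]_n) :
  (forall i l, i != l -> P i :&: P l = finset.set0) ->
  face s P x <-> permutohedron s x /\
    forall j : 'I_k, ssum x (blocks P j) = psum s #|blocks P j|.
Proof.
move=> dP; rewrite /face /=; split=> -[px H]; split=> // j.
  by rewrite card_blocks//; exact: H.
by rewrite -card_blocks//; exact: H.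
Qed.

(** As [x 0 p = x 0 q], the sum over [B] is the mean of those over [B :\ p] and [q |: B], whereas
    [psum] is strictly convex. *)
Lemma ssum_separated n (s : 'I_n -> nat) (x : 'rV[R]_n) p q (B : {set 'I_n}) :
  (forall i j : 'I_n, (i < j)%N -> (s i < s j)%N) ->
  x 0 p = x 0 q -> p \in B -> q \notin B ->
  psum s #|B :\ p| <= ssum x (B :\ p) -> psum s #|q |: B| <= ssum x (q |: B) ->
  psum s #|B| < ssum x B.
Proof.
move=> s_incr xpq pB qB; rewrite cardsU1 qB /= add1n.
have -> : ssum x (q |: B) = x 0 q + ssum x B by rewrite /ssum big_setU1.
have -> : ssum x B = x 0 p + ssum x (B :\ p) by rewrite /ssum (big_setD1 p).
have cB : #|B| = #|B :\ p|.+1 by rewrite (cardsD1 p) pB.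
have Bn : (#|q |: B| <= n)%N by rewrite -[n in (_ <= n)%N]card_ord max_card.
rewrite cardsU1 qB cB in Bn.
have := @psum_convex R n s s_incr #|B :\ p| #|B| #|B| #|B|.+1.
rewrite cB ltnSn => /(_ isT isT _ Bn).
by rewrite addSnnS => /(_ erefl); rewrite xpq; lra.
Qed.

End faces.

(** * Merging the two equal coordinates *)

Section hyperplane_section.
Context {R : realType} {n : nat} (s : 'I_n.+1 -> nat) (b : 'I_n.+1) (c : 'I_n).
Hypothesis s_incr : forall i j : 'I_n.+1, (i < j)%N -> (s i < s j)%N.
Implicit Types (x : 'rV[R]_n.+1) (z : 'rV[R]_n) (A : {set 'I_n}).

Local Notation a := (lift b c).

(* [merge_coords] replaces [x_a] by [2 x_a], which is [x_a + x_b] on the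
   hyperplane, and drops [x_b]; [split_set A] is the set of coordinates of [x]
   whose sum is the sum over [A] of the merged vector. *)
Definition merge_mult (i : 'I_n) : R := 1 + (i == c)%:R.

Definition merge_coords x : 'rV[R]_n := \row_i (x 0 (lift b i) * merge_mult i).

Definition split_coord z : 'rV[R]_n.+1 :=
  \row_j (if unlift b j is Some i then z 0 i / merge_mult i else z 0 c / 2).

Definition split_set A : {set 'I_n.+1} :=
  [set j | if unlift b j is Some i then i \in A else c \in A]%SET.

Lemma merge_mult_neq0 i : merge_mult i != 0.
Proof. by rewrite /merge_mult gt_eqF// ltr_pwDl. Qed.

Lemma splitK z : merge_coords (split_coord z) = z.
Proof.
by apply/rowP => i; rewrite !mxE liftK mulfVK// merge_mult_neq0.
Qed.

Lemma split_eq z : split_coord z 0 a = split_coord z 0 b.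
Proof.
by rewrite !mxE liftK unlift_none /merge_mult eqxx.
Qed.

Lemma mergeK x : x 0 a = x 0 b -> split_coord (merge_coords x) = x.
Proof.
move=> xab; apply/rowP => j; rewrite mxE; case: unliftP => [i ->|->]; rewrite mxE.
  by rewrite mulfK// merge_mult_neq0.
by rewrite -xab /merge_mult eqxx mulfK// gt_eqF.
Qed.

Lemma kdiff_merge k j : kdiff k (fun x => merge_coords x 0 j).
Proof.
under eq_fun do rewrite mxE.
by apply: kdiffM; [exact: kdiff_coord|exact: kdiff_cst].
Qed.

Lemma kdiff_split k j : kdiff k (fun z => split_coord z 0 j).
Proof.
under eq_fun do rewrite mxE; case: (unlift b j) => [i|];
  by apply: kdiffM; [exact: kdiff_coord|exact: kdiff_cst].
Qed.

Lemma big_split_set (T : Type) (idx : T) (op : Monoid.com_law idx) A (f : 'I_n.+1 -> T) :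
  \big[op/idx]_(j in split_set A) f j =
  op (if c \in A then f b else idx) (\big[op/idx]_(i in A) f (lift b i)).
Proof.
rewrite big_mkcond (bigD1_ord b)//= inE unlift_none; congr (op _ _).
by rewrite [RHS]big_mkcond; apply: eq_bigr => i _; rewrite inE liftK.
Qed.

Lemma card_split_set A : #|split_set A| = (#|A| + (c \in A))%N.
Proof.
rewrite -sum1_card big_split_set/= addnC; congr (_ + _)%N.
exact: sum1_card.
Qed.

Lemma ssum_merge x A : x 0 a = x 0 b -> ssum (merge_coords x) A = ssum x (split_set A).
Proof.
move=> xab; rewrite /ssum big_split_set/= addrC.
under eq_bigr do rewrite mxE /merge_mult mulrDr mulr1.
rewrite big_split/=; congr (_ + _); have [cA|cA] := boolP (c \in A).
  rewrite (bigD1 c)//= eqxx mulr1 big1 ?addr0// => i /andP[_ ic].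
  by rewrite (negbTE ic) mulr0.
rewrite big1// => i iA; case: eqP => [ic|_]; last by rewrite mulr0.
by rewrite -ic iA in cA.
Qed.

Lemma split_set_preim (B : {set 'I_n.+1}) : (a \in B) = (b \in B) ->
  split_set [set i | lift b i \in B]%SET = B.
Proof.
move=> abB; apply/finset.setP => j; rewrite inE.
by case: unliftP => [i ->|->]; rewrite inE.
Qed.

Lemma split_setT : split_set finset.setT = finset.setT.
Proof. by apply/finset.setP => j; rewrite !inE; case: unlift => [i|]; rewrite ?inE. Qed.

Let f (B : {set 'I_n.+1}) : R := psum s #|B|.
Let g A : R := psum s #|split_set A|.

(** The size of [split_set A] is that of [A] with [c] counted twice, which is modular and strictly
    increasing in [A]. *)
Lemma supermodular_split_set : supermodular_gap 1 g.
Proof.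
apply: supermodular_psum => // [A B|A B AB|].
- rewrite !card_split_set !inE addnACA cardsUI [RHS]addnACA; congr (_ + _)%N.
  by case: (c \in A); case: (c \in B).
- rewrite !card_split_set -addSn leq_add ?proper_card//.
  have [cA|//] := boolP (c \in A).
  by rewrite (fintype.subsetP (proper_sub AB)).
- by rewrite split_setT cardsT card_ord.
Qed.

Lemma base_merge x : x 0 a = x 0 b -> base_polytope f x -> base_polytope g (merge_coords x).
Proof.
move=> xab [xf xT]; split=> [A|]; rewrite ssum_merge//; first exact: xf.
by rewrite /g split_setT.
Qed.

(** A set containing both or neither of [a], [b] is a split set, so its inequality is one of the
    merged polytope. A set containing exactly one of them lies between two such sets and inherits
    its inequality through [ssum_separated]. *)
Lemma base_split z : base_polytope g z -> base_polytope f (split_coord z).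
Proof.
rewrite -{1}(splitK z); have := split_eq z; move: (split_coord z) => x xab [xg xT].
have balanced (B : {set 'I_n.+1}) : (a \in B) = (b \in B) -> f B <= ssum x B.
  move=> /split_set_preim <-; rewrite -ssum_merge//; exact: xg.
have ab : a != b by rewrite eq_sym neq_lift.
split=> [B|]; last first.
  by rewrite ssum_merge// /g split_setT in xT.
case aB: (a \in B); case bB: (b \in B); first by apply: balanced; rewrite aB bB.
- apply/ltW/(@ssum_separated _ _ _ _ a b) => //; first by rewrite bB.
    by apply: balanced; rewrite !inE eqxx bB andbF.
  by apply: balanced; rewrite !inE eqxx aB orbT.
- apply/ltW/(@ssum_separated _ _ _ _ b a) => //; first by rewrite aB.
    by apply: balanced; rewrite !inE eqxx aB andbF.
  by apply: balanced; rewrite !inE eqxx bB orbT.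
- by apply: balanced; rewrite aB bB.
Qed.

(** With [a] and [b] in one block, every initial union of blocks contains both or neither, so it is
    determined by its elements other than [b]. *)
Lemma split_set_blocks k (P : 'I_k.+1 -> {set 'I_n.+1}) i j :
  (forall i l, i != l -> P i :&: P l = finset.set0) ->
  a \in P i -> b \in P i -> split_set (blocks (reduction b P) j) = blocks P j.
Proof.
move=> dP aP bP.
have inP y : y \in P i -> (y \in blocks P j) = (i <= j)%N.
  move=> yi; apply/bigcupP/idP => [[l lj yl]|ij]; last by exists i.
  have [->//|il] := eqVneq i l.
  by have := finset.in_set0 y; rewrite -(dP _ _ il) inE yi yl.
rewrite -[RHS]split_set_preim ?inP//; congr split_set.
apply/finset.setP => y; rewrite inE.
by apply/bigcupP/bigcupP => -[l lj yl]; exists l => //; rewrite ?in_reduction// -in_reduction.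
Qed.

End hyperplane_section.

Lemma face_separated (R : realType) (n k : nat) (s : 'I_n -> nat)
    (P : 'I_k.+1 -> {set 'I_n}) (x : 'rV[R]_n) p q (i j : 'I_k.+1) :
  (forall i j : 'I_n, (i < j)%N -> (s i < s j)%N) ->
  (forall i l, i != l -> P i :&: P l = finset.set0) ->
  p \in P i -> q \in P j -> (i < j)%N -> x 0 p = x 0 q -> ~ face s P x.
Proof.
move=> s_incr dP pi qj ij xpq /(faceE _ _ dP)[].
rewrite permutohedronE// => -[bx _] H.
(* Block [i] precedes block [j], so it is not the last one and its initial union carries an
   equation; [ssum_separated] contradicts that equation. *)
have ik : (i < k)%N by apply: leq_trans ij _; rewrite -ltnS.
have := H (Ordinal ik) => /= /eqP; apply/negP; rewrite gt_eqF//.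
apply: (ssum_separated s_incr xpq) => //; first by apply/bigcupP; exists i.
apply/bigcupP => -[l /= li ql].
have jl : j != l by apply: contraTneq ij => ->; rewrite -leqNgt.
by have := finset.in_set0 q; rewrite -(dP _ _ jl) inE qj ql.
Qed.

(** * The diffeomorphism of the section and its faces *)

Theorem propositionB12 (R : realType) (n : nat) (s : 'I_n.+1 -> nat)
    (s_gt0 : forall i, (0 < s i)%N)
    (s_incr : forall i j : 'I_n.+1, (i < j)%N -> (s i < s j)%N)
    (a b : 'I_n.+1) (ab : a <> b) :
  let L : set 'rV[R]_n.+1 := [set x : 'rV[R]_n.+1 | x 0 a = x 0 b] in
  exists psi : 'rV[R]_n.+1 -> 'rV[R]_n,
    diffeomorphism (permutohedron s `&` L) (permutohedron (init_seq s)) psi /\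
    forall (k : nat) (P : 'I_k.+1 -> {set 'I_n.+1}), ordered_partition P ->
      (~ (exists i, a \in P i /\ b \in P i) -> face s P `&` L = set0) /\
      ((exists i, a \in P i /\ b \in P i) ->
        diffeomorphism (face s P `&` L)
          (face (init_seq s) (reduction b P)) psi).
Proof.
move=> L; have [c ac] : exists c, a = lift b c.
  by case: (unliftP b a) => [c|//]; exists c.
rewrite ac in L *.
have s'_incr (i j : 'I_n) : (i < j)%N -> (init_seq s i < init_seq s j)%N.
  by move=> ij; exact: s_incr.
have e0 : psum s #|split_set b c finset.set0| =
    psum (init_seq s) #|(finset.set0 : {set 'I_n})| :> R.
  by rewrite card_split_set inE cards0 addn0 !psum0.
have [F [G [[kF kG FK GK bF] tF]]] := base_equiv_supermodular ltr01 e0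
  (supermodular_split_set b c s_incr) (supermodular_psum_card s'_incr).
pose psi x := F (merge_coords b c x); pose inv y := split_coord b c (G y).
have kpsi j k : kdiff k (fun x => psi x 0 j).
  apply: (@kdiff_comp_row _ _ _ _ (fun y => F y 0 j)) => // i.
  exact: kdiff_merge.
have kinv j k : kdiff k (fun y => inv y 0 j).
  apply: (@kdiff_comp_row _ _ _ _ (fun y => split_coord b c y 0 j)) => //.
  exact: kdiff_split.
have Lbase x : (permutohedron s `&` L) x -> base_polytope (fun A => psum s #|split_set b c A|) (merge_coords b c x).
  by rewrite permutohedronE// => -[bx Lx]; exact: base_merge.
have psiA x : (permutohedron s `&` L) x -> permutohedron (init_seq s) (psi x).
  by move=> /Lbase bx; rewrite permutohedronE//; exact/bF.
have invB y : permutohedron (init_seq s) y -> (permutohedron s `&` L) (inv y).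
  rewrite !permutohedronE// => by_; split; last exact: split_eq.
  by apply: base_split => //; apply/bF; rewrite GK.
have psiK x : L x -> inv (psi x) = x.
  by move=> Lx; rewrite /inv /psi FK mergeK.
have invK y : psi (inv y) = y by rewrite /psi /inv splitK GK.
exists psi; split.
  split; first exact: smooth_on_kdiff.
  exists inv; split=> // [|x [_ Lx]]; first exact: smooth_on_kdiff.
  exact: psiK.
move=> k P [_ dP cP]; split=> [nab|[i [aP bP]]].
  apply/seteqP; split=> // x [fx Lx].
  have [i ai] := cP (lift b c); have [j bj] := cP b.
  have [ij|ji|/val_inj ij] := ltngtP i j.
  - exact: (face_separated s_incr dP ai bj ij Lx fx).
  - exact: (face_separated s_incr dP bj ai ji (esym Lx) fx).
  - by apply: nab; exists i; rewrite {2}ij.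
have dr i' l : i' != l -> reduction b P i' :&: reduction b P l = finset.set0.
  move=> il; apply/finset.setP => y; rewrite finset.in_setI !in_reduction -finset.in_setI.
  by rewrite dP// !finset.in_set0.
(* Faces are cut out by tightness of initial unions. Merging turns these into the initial unions of
   the reduction, and [F] respects tightness set by set, so a single [psi] serves all faces. *)
have faceP x : (permutohedron s `&` L) x ->
    (face s P x <-> face (init_seq s) (reduction b P) (psi x)).
  move=> pLx; have [px Lx] := pLx; rewrite !faceE//.
  have H (j : 'I_k) : ssum x (blocks P j) = psum s #|blocks P j| <->
      ssum (psi x) (blocks (reduction b P) j) =
        psum (init_seq s) #|blocks (reduction b P) j|.
    rewrite -(split_set_blocks j dP aP bP) -ssum_merge//.
    exact: tF (Lbase _ pLx).
  split=> -[_ Hj]; split=> [|j]; [exact: psiA|exact/H|by []|exact/H].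
split; first exact: smooth_on_kdiff.
exists inv; split=> [|x [fx Lx]|y fy|x [_ Lx]|y _].
- exact: smooth_on_kdiff.
- by apply/faceP => //; split=> //; case: fx.
- have [py Ly] := invB _ fy.1.
  by split=> //; apply/faceP => //; rewrite invK.
- exact: psiK.
- exact: invK.
Qed.
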